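(* Let $\Gamma$ be a rooted tree, directed away from its root, and let $t\ge 2$ be an integer. Then the simplicial complex $\Delta_t(\Gamma)$, whose facets are the vertex sets of the paths of length $t$ in $\Gamma$, is a simplicial tree.
   Context: A tree is a finite simple graph in which any two distinct vertices are joined by a unique path. A tree $\Gamma$ is viewed as a directed graph by choosing any vertex to be the root and directing every edge away from the root. A path of length $t$ in a directed graph is a sequence of $t$ vertices $x_{i_1},\ldots,x_{i_t}$ such that $(x_{i_j},x_{i_{j+1}})$ is a directed edge for $j=1,\ldots,t-1$ (length counts vertices). For finite sets $F_1,\ldots,F_l$, none contained in another, $\langle F_1,\ldots,F_l\rangle$ denotes the simplicial complex consisting of all subsets of the $F_i$; its facets (inclusion-maximal faces) are $F_1,\ldots,F_l$. Then $$\Delta_t(\Gamma)=\left\langle \{x_{i_1},\ldots,x_{i_t}\} : x_{i_1},\ldots,x_{i_t}\text{ is a path of length }t\text{ in }\Gamma\right\rangle ,$$ which is the empty complex if $\Gamma$ has no path of length $t$. A leaf of a simplicial complex $\Delta$ is a facet $F$ such that either $F$ is the only facet of $\Delta$, or there is a facet $G\ne F$ of $\Delta$ with $F\cap F'\subseteq F\cap G$ for every facet $F'\neq F$ of $\Delta$. A subcomplex of $\Delta$ here means a complex $\langle F_{i_1},\ldots,F_{i_q}\rangle$ generated by a subset of the facets of $\Delta$. A simplicial complex $\Delta$ is a simplicial tree if $\Delta$ is connected and every nonempty subcomplex (in this sense) contains a leaf. By convention the empty simplicial complex is a simplicial tree. *)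

(* Defs.v *)
From mathcomp Require Import all_boot.

Set Implicit Arguments.
Unset Strict Implicit.
Unset Printing Implicit Defensive.

Section Graphs.
Variable V : finType.

Definition simple_path (e : rel V) (x y : V) (p : seq V) : bool :=
  [&& path e x p, last x p == y & uniq (x :: p)].

Definition is_tree (e : rel V) : Prop :=
  [/\ symmetric e, irreflexive e &
      forall x y : V, x != y -> exists! p : seq V, simple_path e x y p].

(* The edge {x, y} is directed from x to y when x lies on a path from the root
   r to y.  A simple path has fewer than #|V| edges, so the bound on n loses
   nothing, as [awayP] shows. *)
Definition away (e : rel V) (r : V) : rel V :=
  [rel x y | e x y &&
    [exists n : 'I_#|V|, exists p : n.-tuple V,
      simple_path e r y p && (x \in r :: p)]].

Lemma awayP (e : rel V) (r x y : V) :
  reflect (e x y /\ exists2 p : seq V, simple_path e r y p & x \in r :: p)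
          (away e r x y).
Proof.
apply: (iffP andP) => -[exy].
  by case/existsP=> n /existsP[p /andP[rp xp]]; split=> //; exists (val p).
case=> p rp xp; split=> //; apply/existsP.
have ltp : size p < #|V|.
  by have /and3P[_ _ /card_uniqP /= rp_size] := rp; rewrite -rp_size max_card.
by exists (Ordinal ltp); apply/existsP; exists (in_tuple p); rewrite /= rp xp.
Qed.

End Graphs.

Section Complexes.
Variable V : finType.

(* The vertex set of a complex is the union of its faces, which may be smaller
   than V; the empty complex has no faces, not even set0. *)
Record complex := Complex {
  faces :> {set {set V}};
  facesS : forall A B : {set V}, A \subset B -> B \in faces -> A \in faces
}.

Definition facets (D : complex) : {set {set V}} :=
  [set F | maxset [pred A | A \in faces D] F].

Definition generated_faces (S : {set {set V}}) : {set {set V}} :=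
  [set A : {set V} | [exists F in S, A \subset F]].

Lemma generated_facesS (S : {set {set V}}) (A B : {set V}) :
  A \subset B -> B \in generated_faces S -> A \in generated_faces S.
Proof.
rewrite !inE => sAB /exists_inP[F SF sBF].
by apply/exists_inP; exists F => //; apply: subset_trans sBF.
Qed.

Definition generated (S : {set {set V}}) : complex :=
  Complex (@generated_facesS S).

Lemma facets_generated (S : {set {set V}}) :
  {in S &, forall F G : {set V}, F \subset G -> F = G} -> facets (generated S) = S.
Proof.
move=> antiS; apply/setP=> F; rewrite inE; apply/idP/idP.
  case/maxsetP; rewrite !inE => /exists_inP[G SG sFG] maxF.
  rewrite -(maxF G) //= inE.
  by apply/exists_inP; exists G.
move=> SF; apply/maxsetP; split=> [|G /=]; rewrite !inE.
  by apply/exists_inP; exists F.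
case/exists_inP=> H SH sGH sFG; apply/eqP; rewrite eqEsubset sFG andbT.
by rewrite (antiS F H) // (subset_trans sFG).
Qed.

Definition is_leaf (D : complex) (F : {set V}) : Prop :=
  F \in facets D /\
  (facets D = [set F] \/
   exists G : {set V}, [/\ G \in facets D, G != F &
     forall F' : {set V}, F' \in facets D -> F' != F ->
       F :&: F' \subset F :&: G]).

Definition facet_adj (D : complex) : rel {set V} :=
  [rel F G | [&& F \in facets D, G \in facets D & F :&: G != set0]].

Definition connected (D : complex) : Prop :=
  {in facets D &, forall F G, connect (facet_adj D) F G}.

Definition simplicial_tree (D : complex) : Prop :=
  connected D /\
  forall S : {set {set V}}, S \subset facets D -> S != set0 ->
    exists F : {set V}, is_leaf (generated S) F.

(* t counts the vertices of the paths. *)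
Definition path_complex (d : rel V) (t : nat) : complex :=
  generated [set [set x in tval s] | s : t.-tuple V & sorted d s].

End Complexes.

(* Main.v *)
Require Import Defs.
From mathcomp Require Import all_boot.

Set Implicit Arguments.
Unset Strict Implicit.
Unset Printing Implicit Defensive.

(** Write [path_to y] for the path from the root to [y], root included.  A
directed path with t vertices ending at y consists of the last t entries of
[path_to y].  Hence, if F is a facet of a subcomplex whose last vertex has maximal
depth, F meets any other facet F' exactly in the vertices of F that lie above
the last vertex of F'.  Such sets are initial segments of F, so they form a
chain under inclusion, and any G maximizing #|F :&: G| shows that F is a leaf.
For connectedness, shifting a path one step towards the root gives a facet
meeting it, and all facets starting at the root share the root. *)

Section RootedTree.
Variables (V : finType) (e : rel V) (r : V).
Hypothesis e_tree : is_tree e.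

(** * Paths from the root and the ancestor relation *)

Lemma simple_path_exists x y : exists p, simple_path e x y p.
Proof.
have [_ _ ex1_path] := e_tree.
case: (eqVneq x y) => [<-|/ex1_path[p [xp _]]]; last by exists p.
by exists [::]; rewrite /simple_path /= eqxx.
Qed.

(** [is_tree] gives uniqueness for distinct endpoints only. When they coincide, a nonempty [p] would
    end in its starting vertex and so repeat it. *)
Lemma simple_path_inj x y p q :
  simple_path e x y p -> simple_path e x y q -> p = q.
Proof.
have [_ _ ex1_path] := e_tree.
case: (eqVneq x y) => [<-|/ex1_path[s [_ s_uniq]] xp xq]; last first.
  by rewrite -(s_uniq p xp) -(s_uniq q xq).
have nil s : simple_path e x x s -> s = [::].
  case: s => //= z s /and3P[_ /eqP/= last_s] /andP[/negP[]].
  by rewrite -[X in X \in _]last_s mem_last.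
by move=> /nil-> /nil->.
Qed.

Definition path_to y : seq V := r :: xchoose (simple_path_exists r y).

Lemma path_toP y : exists2 p, path_to y = r :: p & simple_path e r y p.
Proof. by exists (xchoose (simple_path_exists r y)); last apply: xchooseP. Qed.

Lemma path_toE y p : simple_path e r y p -> path_to y = r :: p.
Proof. by have [q -> rq] := path_toP y; move=> rp; rewrite (simple_path_inj rp rq). Qed.

Lemma path_to_uniq y : uniq (path_to y).
Proof. by have [p -> /and3P[]] := path_toP y. Qed.

Lemma mem_path_to y : y \in path_to y.
Proof. by have [p -> /and3P[_ /eqP <- _]] := path_toP y; apply: mem_last. Qed.

Lemma path_to_root : path_to r = [:: r].
Proof. by apply: path_toE; rewrite /simple_path /= eqxx. Qed.

(** Cutting the path to [y] right after [x] leaves a simple path from the root to [x], which is the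
    only one. *)
Lemma path_to_prefix x y : x \in path_to y -> prefix (path_to x) (path_to y).
Proof.
have [p -> /and3P[rp _ r_p]] := path_toP y.
rewrite inE => /orP[/eqP->|/splitPr xp]; first by rewrite path_to_root /= eqxx prefix0s.
case: xp rp r_p => p1 p2; rewrite -cat_rcons cat_path -cat_cons cat_uniq.
move=> /andP[rp _] /andP[r_p _].
by rewrite (@path_toE x (rcons p1 x)) ?prefix_prefix // /simple_path rp last_rcons eqxx.
Qed.

Lemma path_to_trans x y z :
  x \in path_to y -> y \in path_to z -> x \in path_to z.
Proof. by move=> xy /path_to_prefix/prefixP[s ->]; rewrite mem_cat xy. Qed.

(** Both root paths are prefixes of [path_to z], so the shorter one is a prefix of the longer. *)
Lemma path_to_total x y z :
  x \in path_to z -> y \in path_to z -> (x \in path_to y) || (y \in path_to x).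
Proof.
wlog le_xy: x y / size (path_to x) <= size (path_to y) => [IH xz yz|].
  have [/IH|/ltnW/IH] := leqP (size (path_to x)) (size (path_to y)); first exact.
  by rewrite orbC; apply.
move=> /path_to_prefix/prefixP[s defz] /path_to_prefix/prefixP[s' defz'].
apply/orP; left; apply: (@mem_take (size (path_to x)) V); move: (mem_path_to x).
by rewrite -{1}(take_size_cat s (erefl (size (path_to x)))) -defz defz' takel_cat.
Qed.

Lemma path_to_away x y : away e r x y -> path_to y = rcons (path_to x) y.
Proof.
have [_ e_irr _] := e_tree.
case/awayP=> exy [p rp]; rewrite -(path_toE rp) => xy.
(* Otherwise each root path would be a prefix of the other. They would then coincide and have the
   same last vertex, so the edge from [x] to [y] would be a loop. *)
have nyx : y \notin path_to x.
  have /prefixP[s defy] := path_to_prefix xy; apply/negP=> yx.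
  have /prefixP[s'] := path_to_prefix yx; rewrite defy -catA.
  move=> /(congr1 size)/eqP; rewrite !size_cat -[X in X == _]addn0 eqn_add2l eq_sym.
  rewrite addn_eq0 !size_eq0 => /andP[/eqP s0 _]; move: defy; rewrite s0 cats0.
  have [px -> /and3P[_ /eqP lastx _]] := path_toP x.
  have [py -> /and3P[_ /eqP lasty _]] := path_toP y.
  by case=> eq_p; move: exy; rewrite -lastx -lasty eq_p e_irr.
have [px defx /and3P[rpx /eqP lastx r_px]] := path_toP x.
rewrite defx rcons_cons; apply: path_toE.
rewrite /simple_path rcons_path rpx lastx exy last_rcons eqxx.
by rewrite -rcons_cons rcons_uniq -defx nyx path_to_uniq.
Qed.

Lemma away_parent y : y != r -> exists x, away e r x y.
Proof.
have [p _] := path_toP y; case/lastP: p => [|p z rp _].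
  by case/and3P=> _ /= /eqP->; rewrite eqxx.
exists (last r p); apply/awayP; split; last first.
  by exists (rcons p z); rewrite // -rcons_cons mem_rcons inE mem_last orbT.
by case/and3P: rp; rewrite rcons_path last_rcons => /andP[_ ?] /eqP<-.
Qed.

Lemma path_to_last x q :
  path (away e r) x q -> path_to (last x q) = path_to x ++ q.
Proof.
elim: q x => [|y q IHq] x /=; first by rewrite cats0.
by case/andP=> xy /IHq->; rewrite (path_to_away xy) cat_rcons.
Qed.

Lemma path_to_rcons x : exists s, path_to x = rcons s x.
Proof.
have [p -> /and3P[_ /eqP lastx _]] := path_toP x.
by exists (belast r p); rewrite -[in RHS]lastx -lastI.
Qed.

(** A vertex [z] of [path_to y] occurs there once, at index [size (path_to z) - 1], because
    [path_to z] is a prefix ending in [z]. *)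
Lemma mem_drop_path_to k y z :
  (z \in drop k (path_to y)) = (z \in path_to y) && (k < size (path_to z)).
Proof.
apply/idP/andP=> [zk|[/path_to_prefix/prefixP[s ->] ltk]]; last first.
  have [s' defz] := path_to_rcons z; move: ltk; rewrite defz size_rcons => lek.
  by rewrite drop_cat size_rcons lek drop_rcons // mem_cat mem_rcons mem_head.
have zy := mem_drop zk; split=> //; rewrite ltnNge; apply/negP=> lek.
have /prefixP[s defy] := path_to_prefix zy.
move: zk (path_to_uniq y); rewrite defy drop_cat ltnNge lek => /mem_drop zs.
by rewrite cat_uniq => /and3P[_ /hasPn/(_ z zs)/negP[]]; apply: mem_path_to.
Qed.

(** * Directed paths as final segments of root paths *)

Definition chain_to t y : {set V} :=
  [set z in drop (size (path_to y) - t) (path_to y)].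

Lemma path_vertices x q : path (away e r) x q ->
  [set z in x :: q] = chain_to (size q).+1 (last x q).
Proof.
move=> /path_to_last defy; apply/setP=> z; rewrite !inE defy.
have [s ->] := path_to_rcons x.
by rewrite cat_rcons size_cat addnK drop_size_cat.
Qed.

Lemma path_size x q : path (away e r) x q ->
  size q < size (path_to (last x q)).
Proof. by move=> /path_to_last->; rewrite size_cat /path_to /= addSn ltnS leq_addl. Qed.

(** As [y] is at least as deep as [y'], the depth bound for lying in [chain_to t y] implies the one
    for [chain_to t y']; only the ancestor condition remains. *)
Lemma chain_toIl t y y' : size (path_to y') <= size (path_to y) ->
  chain_to t y :&: chain_to t y' = [set z in chain_to t y | z \in path_to y'].
Proof.
move=> le_y'y; apply/setP=> z; rewrite !inE !mem_drop_path_to.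
case zy: (_ < size _); rewrite ?andbF //= (leq_ltn_trans _ zy) ?andbT //.
exact: leq_sub2r.
Qed.

Lemma card_chain_to t y : t <= size (path_to y) -> #|chain_to t y| = t.
Proof.
move=> le_t; rewrite cardsE (card_uniqP _) ?drop_uniq ?path_to_uniq //.
by rewrite size_drop subKn.
Qed.

Lemma chain_to_anti t y z : t <= size (path_to y) -> t <= size (path_to z) ->
  chain_to t y \subset chain_to t z -> chain_to t y = chain_to t z.
Proof. by move=> ty tz sFG; apply/eqP; rewrite eqEcard sFG !card_chain_to /=. Qed.

(** * Existence of a leaf *)

Lemma chains_have_leaf t (S : {set {set V}}) : S != set0 ->
    (forall F, F \in S -> exists2 y, t <= size (path_to y) & F = chain_to t y) ->
  exists F, is_leaf (generated S) F.
Proof.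
move=> /set0Pn[F1 SF1] chainS.
have facetsS : facets (generated S) = S.
  apply: facets_generated => F G /chainS[y ty ->] /chainS[z tz ->].
  exact: chain_to_anti.
have [y1 t1 defF1] := chainS F1 SF1; rewrite {}defF1 {t1} in SF1.
(* The maximum is over all vertices whose chain lies in [S], so [y_max] applies to the end vertex of
   any member of [S]. *)
case: (@arg_maxnP _ y1 [pred y | chain_to t y \in S] (fun y => size (path_to y)) SF1).
move=> y /= Sy y_max; exists (chain_to t y); split; rewrite facetsS //.
have [defS|] := eqVneq S [set chain_to t y]; [by left | move=> /eqP neqS; right].
have /set0Pn[F2 S'F2] : S :\ chain_to t y != set0.
  by apply/eqP=> S'0; apply: neqS; rewrite -(setD1K Sy) S'0 setU0.
pose meet G := #|chain_to t y :&: G|.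
case: (@arg_maxnP _ F2 [pred G in S :\ chain_to t y] meet S'F2).
move=> G /setD1P[neqG SG] G_max; exists G; split=> // F SF neqF.
have shape H : H \in S -> exists y',
    chain_to t y :&: H = [set z in chain_to t y | z \in path_to y'].
  move=> SH; have [y' _ defH] := chainS H SH; exists y'.
  by rewrite defH chain_toIl // y_max //= -defH.
have {shape} [[yF defF] [yG defG]] := (shape F SF, shape G SG).
(* Suppose [z] lies in the intersection with [F] but not with [G]. Every [w] in the intersection
   with [G] is comparable to [z] and cannot lie below it, so it lies above [z] and hence in [F].
   Thus [F] has the strictly larger intersection, against the choice of [G]. *)
apply: contraT => /subsetPn[z]; rewrite defF defG !inE => /andP[yz zF].
rewrite {1}yz /= => zG; have /G_max : F \in S :\ chain_to t y by apply/setD1P.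
rewrite /= leqNgt => /negP[]; apply/proper_card; apply/properP; split; last first.
  by exists z; [rewrite defF inE inE yz | rewrite defG inE negb_and zG orbT].
rewrite defF defG; apply/subsetP=> w; rewrite !inE => /andP[yw wG]; rewrite yw /=.
have /orP[wz|zw] := path_to_total (mem_drop yw) (mem_drop yz).
  exact: path_to_trans wz zF.
by case/negP: zG; apply: path_to_trans zw wG.
Qed.

(** * Facets of the path complex and connectedness *)

Definition path_sets t : {set {set V}} :=
  [set [set x in tval s] | s : t.-tuple V & sorted (away e r) s].

Lemma path_setsP t F :
  reflect (exists x q, [/\ path (away e r) x q, size q = t & F = [set z in x :: q]])
          (F \in path_sets t.+1).
Proof.
apply: (iffP imsetP) => [[s]|[x [q [xq sz_q ->]]]].
  by case/tupleP: s => x q; rewrite inE => xq ->; exists x, q; rewrite size_tuple.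
have sz_xq : size (x :: q) == t.+1 by rewrite /= sz_q.
by exists (Tuple sz_xq); rewrite ?inE.
Qed.

Lemma path_sets_chain t F : F \in path_sets t.+1 ->
  exists2 y, t.+1 <= size (path_to y) & F = chain_to t.+1 y.
Proof.
case/path_setsP=> x [q [xq <- ->]].
by exists (last x q); rewrite ?path_size ?path_vertices.
Qed.

Lemma facets_path_complex t :
  facets (path_complex (away e r) t.+1) = path_sets t.+1.
Proof.
apply: facets_generated => F G /path_sets_chain[y ty ->] /path_sets_chain[z tz ->].
exact: chain_to_anti.
Qed.

Lemma facet_adj_path_complex t F G :
  facet_adj (path_complex (away e r) t.+1) F G =
    [&& F \in path_sets t.+1, G \in path_sets t.+1 & F :&: G != set0].
Proof. by rewrite -facets_path_complex. Qed.

Lemma connect_root_facet t F : F \in path_sets t.+2 ->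
  exists2 G, G \in path_sets t.+2 & r \in G /\
    connect (facet_adj (path_complex (away e r) t.+2)) F G.
Proof.
case/path_setsP=> x [q [xq sz_q ->]].
have [n] := ubnP (size (path_to x)); elim: n x q xq sz_q => // n IHn x q xq sz_q ltxn.
have paths_xq : [set z in x :: q] \in path_sets t.+2 by apply/path_setsP; exists x, q.
have [x_r|/away_parent[w wx]] := eqVneq x r.
  by exists [set z in x :: q]; rewrite // !inE x_r eqxx.
(* Paths have at least two vertices, so [x] survives when the last vertex [z] is dropped and the
   parent [w] is put in front; both facets contain [x]. *)
case/lastP: q => [|q z] // in xq sz_q paths_xq *.
have wxq : path (away e r) w (x :: q).
  by move: xq; rewrite rcons_path /= wx => /andP[].
have sz_xq : size (x :: q) = t.+1 by rewrite -sz_q size_rcons.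
have [|G paths_G [rG wG]] := IHn w (x :: q) wxq sz_xq.
  by move: ltxn; rewrite (path_to_away wx) size_rcons.
exists G; rewrite // rG; split=> //; apply: connect_trans (connect1 _) wG.
rewrite facet_adj_path_complex paths_xq andTb; apply/andP; split.
  by apply/path_setsP; exists w, (x :: q).
by apply/set0Pn; exists x; rewrite !inE eqxx orbT.
Qed.

End RootedTree.

Theorem theorem2p7 (V : finType) (e : rel V) (r : V) (t : nat)
  (e_tree : is_tree e) (t_ge2 : 2 <= t) :
  simplicial_tree (path_complex (away e r) t).
Proof.
case: t t_ge2 => [|[|t]] // _; split=> [F G|S].
  rewrite !(facets_path_complex r e_tree).
  move=> /(connect_root_facet e_tree)[F' pF' [rF' FF']].
  move=> /(connect_root_facet e_tree)[G' pG' [rG' GG']].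
  have adj_sym : symmetric (facet_adj (path_complex (away e r) t.+2)).
    by move=> A B; rewrite !(facet_adj_path_complex r e_tree) setIC andbCA.
  apply: connect_trans FF' _; rewrite sym_connect_sym //.
  apply: connect_trans GG' (connect1 _).
  rewrite (facet_adj_path_complex r e_tree) pF' pG'.
  by apply/set0Pn; exists r; rewrite inE rF' rG'.
rewrite (facets_path_complex r e_tree) => /subsetP sS S_neq0.
apply: (chains_have_leaf (e_tree := e_tree) (r := r) (t := t.+2) S_neq0) => F /sS.
exact: path_sets_chain.
Qed.
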